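(* Let $G$ be a connected graph of order $n$. Then the following are equivalent: (1) $G$ is a tree. (2) $G$ satisfies (Emb): $G$ embeds in every graph $G'$ with minimum degree $\delta(G') \geq n-1$. (3) $G$ satisfies (PG): $R(G,K_p) = (n-1)(p-1)+1$ for all integers $p \geq 3$. In particular, the collection of connected graphs that are $p$-good for all $p$ is precisely the collection of trees.
   Context: Graphs are finite, simple and have at least one vertex; the order of a graph is its number of vertices, and $\delta$ denotes minimum degree. $R(G,H)$ denotes the ordinary 2-color Ramsey number: the minimum $N$ such that every coloring of the edges of $K_N$ in red and blue contains a red copy of $G$ or a blue copy of $H$ (as a not necessarily induced subgraph). A graph $H$ embeds in $G'$ if $G'$ contains a (not necessarily induced) subgraph isomorphic to $H$. A connected graph $G$ of order $n$ is called $p$-good if $R(G,K_p) = (n-1)(p-1)+1$. ''$p$-good for all $p$'' means condition (PG), i.e. $p$-good for all $p \geq 3$. *)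

(* Defs.v *)
From HB Require Import structures.
From mathcomp Require Import all_boot.

Set Implicit Arguments.
Unset Strict Implicit.
Unset Printing Implicit Defensive.

(* The vertex type may be empty here; "at least one vertex" is the explicit
   hypothesis 0 < #|G| wherever a graph of the theory is quantified over. *)
Record sgraph := SGraph {
  vertex :> finType;
  adj : rel vertex;
  adj_sym : symmetric adj;
  adj_irr : irreflexive adj
}.

(* Not necessarily induced: non-edges are unconstrained. *)
Definition embeds (H G : sgraph) : Prop :=
  exists f : H -> G, injective f /\ forall x y : H, adj x y -> adj (f x) (f y).

Definition is_connected (G : sgraph) : Prop :=
  forall x y : G, connect (@adj G) x y.

(* A closed walk x y x of length 2 is not a cycle, hence 2 < size s. *)
Definition acyclic (G : sgraph) : Prop :=
  ~ exists s : seq G, 2 < size s /\ ucycle (@adj G) s.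

Definition is_tree (G : sgraph) : Prop := is_connected G /\ acyclic G.

Definition degree (G : sgraph) (x : G) : nat := #|[set y : G | adj x y]|.

(* The default #|G| exceeds every degree, so it is never the value of the
   minimum when G has a vertex. *)
Definition min_degree (G : sgraph) : nat :=
  \big[minn/#|G|]_(x : G) degree x.

Section CompleteGraph.
Variable p : nat.

Definition complete_adj : rel 'I_p := fun x y => x != y.

Fact complete_sym : symmetric complete_adj.
Proof. by move=> x y; rewrite /complete_adj eq_sym. Qed.

Fact complete_irr : irreflexive complete_adj.
Proof. by move=> x; rewrite /complete_adj eqxx. Qed.

Definition complete : sgraph := SGraph complete_sym complete_irr.
End CompleteGraph.

(* A colouring of the edges of K_N is given by c : {set 'I_N} -> bool; only its
   values on the pairs [set x; y] with x != y are used. true is red, false is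
   blue. *)
Section ColorClass.
Variables (N : nat) (c : {set 'I_N} -> bool) (b : bool).

Definition color_adj : rel 'I_N := fun x y => (x != y) && (c [set x; y] == b).

Fact color_sym : symmetric color_adj.
Proof. by move=> x y; rewrite /color_adj eq_sym setUC. Qed.

Fact color_irr : irreflexive color_adj.
Proof. by move=> x; rewrite /color_adj eqxx. Qed.

Definition color_class : sgraph := SGraph color_sym color_irr.
End ColorClass.

Definition arrows (N : nat) (G H : sgraph) : Prop :=
  forall c : {set 'I_N} -> bool,
    embeds G (color_class c true) \/ embeds H (color_class c false).

(* R(G, H) = N *)
Definition is_ramsey (G H : sgraph) (N : nat) : Prop :=
  arrows N G H /\ forall M, arrows M G H -> N <= M.

Definition good (p : nat) (G : sgraph) : Prop :=
  is_ramsey G (complete p) ((#|G| - 1) * (p - 1) + 1).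

Definition Emb (G : sgraph) : Prop :=
  forall G' : sgraph, 0 < #|G'| -> #|G| - 1 <= min_degree G' -> embeds G G'.

Definition PG (G : sgraph) : Prop := forall p : nat, 3 <= p -> good p G.

(* Main.v *)
Require Import Defs.
From HB Require Import structures.
From mathcomp Require Import all_boot.
From mathcomp Require Import zify.

Set Implicit Arguments.
Unset Strict Implicit.
Unset Printing Implicit Defensive.

(** A tree embeds greedily in any graph of minimum degree at least [n - 1]:
    growing a connected vertex set one vertex at a time, each new vertex has a
    single neighbour among those already placed (two would close a cycle), and
    the image of that neighbour has more neighbours than there are other used
    vertices ([tree_Emb]).

    If [G] satisfies (Emb) and a red-blue colouring has no red [G], then every
    nonempty set of vertices contains one with fewer than [n - 1] red
    neighbours inside the set. Repeatedly picking such a vertex and discarding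
    its red neighbours costs at most [n - 1] vertices per step and builds a blue
    clique; this is the upper bound in (PG). The lower bound holds for every
    connected [G]: colour [p - 1] disjoint cliques of order [n - 1] red and all
    other edges blue ([Emb_PG]).

    Finally, let [G] contain a cycle of length [k]. It suffices to refute
    (PG) for one value of [p], so some graph without [k]-cycles is needed that
    has more than [(n - 1) b] vertices but no independent set of more than [b].
    Such a graph comes from the deletion method of Erdos
    ([sparse_graph_few_independent]). Take [N = n b] vertices and a uniformly
    random sequence of [M = 2 n^2 N] ordered pairs of vertices as edges. The
    expected number of [k]-cycles is at most [(4 n^2)^k], a constant
    independent of [b], while the expected number of independent sets of more
    than [b] vertices is at most [2^-N]. So for [b] a little larger than that
    constant some outcome has no such independent set and fewer than [b]
    cycles, and removing one vertex from each of them leaves more than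
    [(n - 1) b] vertices. Constant average degree is enough because only the
    ratio of order to independence number matters. Probabilities are replaced
    by counts over the finite set of all sequences. *)

(** * Minimum degree *)

Lemma leq_min_degree (G : sgraph) (x : G) : min_degree G <= degree x.
Proof.
rewrite /min_degree; have := mem_index_enum x.
elim: (index_enum _) => // y s IHs; rewrite inE big_cons geq_min.
by case/predU1P=> [<- | /IHs ->]; rewrite ?leqnn ?orbT.
Qed.

Lemma min_degree_geq (G : sgraph) d :
  d <= #|G| -> (forall x : G, d <= degree x) -> d <= min_degree G.
Proof.
move=> leG le_deg; rewrite /min_degree.
by elim/big_ind: _ => // m1 m2; rewrite leq_min => -> ->.
Qed.

(** * Greedy embedding of trees *)

Definition in_adj (G : sgraph) (S : {set G}) : rel G :=
  [rel x y | [&& x \in S, y \in S & adj x y]].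

Definition connected_in (G : sgraph) (S : {set G}) : Prop :=
  {in S &, forall x y, connect (in_adj S) x y}.

Lemma connected_in_add (G : sgraph) (S : {set G}) x y :
  connected_in S -> y \in S -> adj x y -> connected_in (x |: S).
Proof.
move=> connS yS xy.
have symS : connect_sym (in_adj (x |: S)).
  by apply: sym_connect_sym => u v; rewrite /in_adj /= adj_sym andbCA.
have to_y z : z \in x |: S -> connect (in_adj (x |: S)) z y.
  case/setU1P=> [-> | zS].
    by apply: connect1; rewrite /in_adj /= !inE eqxx yS xy orbT.
  apply: connect_sub (connS z y zS yS) => u v /and3P[uS vS uv].
  by apply: connect1; rewrite /in_adj /= !inE uS vS uv !orbT.
by move=> u v /to_y uy /to_y; rewrite symS; apply: connect_trans uy.
Qed.

(** Otherwise a path from [y] to [z] inside [S] would close up through [x]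
    into a cycle. *)
Lemma acyclic_unique_neighbor (G : sgraph) (S : {set G}) x y z :
  acyclic G -> connected_in S -> x \notin S -> y \in S -> z \in S ->
  adj x y -> adj x z -> y = z.
Proof.
move=> acyG connS xS yS zS xy xz; apply/eqP/negPn/negP=> yz; apply: acyG.
have [p0 p0P zE] := connectP (connS y z yS zS).
case/shortenP: p0P zE => p pP p_uniq _ zE.
have pG : path (@adj G) y p by apply: sub_path pP => u v /and3P[].
have pS : {subset p <= S}.
  have in_S q u : path (in_adj S) u q -> {subset q <= S}.
    elim: q u => // v q IHq u /= /andP[/and3P[_ vS _] /IHq qS] w.
    by case/predU1P=> [-> | /qS].
  exact: in_S pP.
exists [:: x, y & p]; split.
  by case: p zE {pP p_uniq pG pS} => //= yz'; rewrite yz' eqxx in yz.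
rewrite /ucycle /= rcons_path pG xy -zE adj_sym xz /=.
rewrite -/(uniq (y :: p)) p_uniq andbT inE negb_or.
rewrite (contraNneq _ xS) => [|->//].
by apply: contra xS => /pS.
Qed.

Lemma connected_exit (G : sgraph) (S : {set G}) :
  is_connected G -> S != set0 -> S != setT ->
  exists x y, [/\ x \notin S, y \in S & adj x y].
Proof.
move=> connG /set0Pn[a aS]; rewrite -subTset => /subsetPn[b _ bS].
have [p] := connectP (connG a b).
elim: p a aS => [|c p IHp] a aS /=; first by move=> _ ba; rewrite ba aS in bS.
case/andP=> ac cp bE; have [cS | cS] := boolP (c \in S); first exact: IHp cp bE.
by exists c, a; rewrite adj_sym.
Qed.

(** The partial embeddings are total functions [f] constrained only on a
    connected set [S], which grows from a single vertex to all of [G]. *)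
Lemma tree_Emb (G : sgraph) : 0 < #|G| -> is_tree G -> Emb G.
Proof.
move=> G_gt0 [connG acyG] H H_gt0 degH.
have [[g _] [h _]] := (card_gt0P G_gt0, card_gt0P H_gt0).
suff [S [f [cardS _ f_inj f_hom]]] : exists (S : {set G}) (f : G -> H),
    [/\ #|S| = #|G|, connected_in S, {in S &, injective f}
      & {in S &, forall x y, adj x y -> adj (f x) (f y)}].
  have ST : S = setT by apply/eqP; rewrite eqEcard subsetT cardsT cardS /=.
  by exists f; split=> x y; [apply: f_inj | apply: f_hom]; rewrite ST inE.
have: 0 < #|G| <= #|G| by rewrite G_gt0 leqnn.
elim: {1 2 4}#|G| => // -[_ _ | m IHm /andP[_ ltm]].
  exists [set g], (fun=> h); split; rewrite ?cards1 //.
  - by move=> x y /set1P-> /set1P->.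
  - by move=> x y /set1P-> /set1P->.
  by move=> x y /set1P-> /set1P->; rewrite adj_irr.
have [|S [f [cardS connS f_inj f_hom]]] := IHm; first by rewrite /= ltnW.
have S0 : S != set0 by rewrite -card_gt0 cardS.
have ST : S != setT by apply: contraTneq ltm => ST; rewrite -cardS ST cardsT ltnn.
have [x [y [xS yS xy]]] := connected_exit connG S0 ST.
have [w fyw wfS] : exists2 w, adj (f y) w & w \notin f @: S.
  (* f y is not its own neighbour, so only the images of S :\ y are in the way. *)
  have /subsetPn[w] : ~~ ([set w | adj (f y) w] \subset f @: (S :\ y)).
    apply/negP=> /subset_leq_card; apply/negP; rewrite -ltnNge.
    apply: leq_ltn_trans (leq_imset_card _ _) _.
    apply: leq_trans (leq_min_degree (f y)); apply: leq_trans degH.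
    by move: cardS; rewrite (cardsD1 y) yS; lia.
  rewrite inE => fyw wS; exists w => //; apply: contra wS => /imsetP[z zS wz].
  apply/imsetP; exists z; rewrite // !inE zS andbT.
  by apply: contraTneq fyw => zy; rewrite wz zy adj_irr.
pose f' z := if z == x then w else f z.
have f'x : f' x = w by rewrite /f' eqxx.
have f'S z : z \in S -> f' z = f z.
  by move=> zS; rewrite /f' (negPf (contraTneq _ zS)) // => ->.
exists (x |: S), f'; split.
- by rewrite cardsU1 xS cardS.
- exact: connected_in_add connS yS xy.
- move=> u v /setU1P[-> | uS] /setU1P[-> | vS]; rewrite ?f'x ?f'S //.
  + by move=> wE; rewrite wE imset_f in wfS.
  + by move=> wE; rewrite -wE imset_f in wfS.
  by apply: f_inj.
move=> u v /setU1P[-> | uS] /setU1P[-> | vS]; rewrite ?f'x ?f'S //.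
- by rewrite adj_irr.
- by move=> xv; rewrite -(acyclic_unique_neighbor acyG connS xS yS vS xy xv) adj_sym.
- rewrite adj_sym => xu.
  by rewrite -(acyclic_unique_neighbor acyG connS xS yS uS xy xu).
by apply: f_hom.
Qed.

(** * Ramsey numbers of connected graphs versus complete graphs *)

(** Each chosen vertex rules out at most [d] vertices of [S], namely itself and
    its fewer than [d] neighbours, hence [p] choices leave room for one
    more. *)
Lemma degenerate_independent (H : sgraph) d :
  (forall S : {set H}, S != set0 ->
     exists2 x, x \in S & #|[set y in S | adj x y]| < d) ->
  forall p (S : {set H}), d * p < #|S| ->
  exists K : {set H}, [/\ K \subset S, #|K| = p.+1
    & {in K &, forall x y, ~~ adj x y}].
Proof.
move=> degen; elim=> [|p IHp] S ltS.
  have [x xS] : exists x, x \in S by apply/set0Pn; rewrite -card_gt0; lia.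
  exists [set x]; rewrite sub1set cards1; split=> // u v /set1P-> /set1P->.
  by rewrite adj_irr.
have [|x xS ltd] := degen S; first by rewrite -card_gt0; lia.
pose S' := S :\: (x |: [set y in S | adj x y]).
have [|K [sKS' cardK indepK]] := IHp S'.
  have le1 := leq_subr (#|S :&: (x |: [set y in S | adj x y])|) #|S|.
  have := subset_leq_card (subsetIr S (x |: [set y in S | adj x y])).
  rewrite /S' cardsD; have [+ _] := leq_card_setU [set x] [set y in S | adj x y].
  by rewrite cards1; move: ltS; rewrite mulnS; lia.
have nK y : y \in K -> [/\ y != x, y \in S & ~~ adj x y].
  move=> /(subsetP sKS'); rewrite !inE negb_or => /andP[/andP[-> xy] yS].
  by move: xy; rewrite yS.
exists (x |: K); split.
- by apply/subsetP=> y /setU1P[-> // | /nK[]].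
- by rewrite cardsU1 cardK; case: (boolP (x \in K)) => // /nK[]; rewrite eqxx.
move=> u v /setU1P[-> | uK] /setU1P[-> | vK].
- by rewrite adj_irr.
- by case: (nK v vK).
- by rewrite adj_sym; case: (nK u uK).
exact: indepK.
Qed.

Section Induced.
Variables (G : sgraph) (S : {set G}).
Definition induced_adj : rel {x | x \in S} := fun x y => adj (val x) (val y).
Fact induced_sym : symmetric induced_adj.
Proof. by move=> x y; apply: adj_sym. Qed.
Fact induced_irr : irreflexive induced_adj.
Proof. by move=> x; apply: adj_irr. Qed.
Definition induced : sgraph := SGraph induced_sym induced_irr.

Lemma degree_induced (x : induced) :
  degree x = #|[set y in S | adj (val x) y]|.
Proof.
rewrite /degree -(card_imset _ val_inj); apply: eq_card => y; rewrite inE.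
apply/imsetP/andP=> [[z] | [yS xy]]; first by rewrite inE => xz ->; split=> //; apply: valP.
by exists (Sub y yS); rewrite ?inE /= /induced_adj.
Qed.
End Induced.

(** (Emb) applies to the subgraph induced by [S]. *)
Lemma Emb_dense_set (G H : sgraph) (S : {set H}) :
  Emb G -> S != set0 ->
  (forall x, x \in S -> #|G| - 1 <= #|[set y in S | adj x y]|) -> embeds G H.
Proof.
move=> embG S0 degS.
have cardS : #|induced S| = #|S| by rewrite /= card_sig; apply: eq_card.
case: (embG (induced S)) => [||f [f_inj f_hom]].
- by rewrite cardS card_gt0.
- apply: min_degree_geq => [|x]; last by rewrite degree_induced; apply: degS (valP x).
  have [x xS] := set0Pn _ S0; rewrite cardS; apply: leq_trans (degS x xS) _.
  by apply: subset_leq_card; apply/subsetP=> y; rewrite inE => /andP[].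
by exists (val \o f); split=> [|x y /f_hom //]; apply: inj_comp val_inj f_inj.
Qed.

(** Either the red graph has a subgraph of minimum degree at least [n - 1], and
    (Emb) yields a red [G], or it is degenerate, and a set that is independent
    in red is a blue clique. *)
Lemma Emb_arrows (G : sgraph) p :
  Emb G -> arrows ((#|G| - 1) * p + 1) G (complete p.+1).
Proof.
move=> embG c; set N := _ + 1; pose R := color_class c true.
have [[S /andP[S0 /forall_inP degS]] | noS] :=
    pickP [pred S : {set R} | (S != set0) &&
      [forall x in S, #|G| - 1 <= #|[set y in S | adj x y]|]].
  by left; apply: Emb_dense_set embG S0 degS.
right; have [S S0||K [_ cardK indK]] := @degenerate_independent R (#|G| - 1) _ p setT.
- have /negbT := noS S; rewrite /= S0 negb_forall_in => /exists_inP[x xS].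
  by rewrite -ltnNge; exists x.
- by rewrite cardsT card_ord /N; lia.
pose f (i : complete p.+1) : color_class c false := enum_val (cast_ord (esym cardK) i).
have f_inj : injective f by move=> i j /enum_val_inj/cast_ord_inj.
exists f; split=> // i j; rewrite /= /complete_adj => ij; rewrite /color_adj (inj_eq f_inj) ij /=.
have := indK _ _ (enum_valP (cast_ord (esym cardK) i)) (enum_valP (cast_ord (esym cardK) j)).
by rewrite /= /color_adj -/(f i) -/(f j) (inj_eq f_inj) ij; case: (c _).
Qed.

(** Both constructions of colourings avoiding [G] and [K_p] are relations on
    some finite type rather than functions on subsets of an ordinal; this lemma
    transfers the arrow property to them. *)
Lemma arrows_rel M (G H : sgraph) (T : finType) (S : {set T}) (r : rel T) :
  symmetric r -> arrows M G H -> M <= #|S| ->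
  (exists f : G -> T, [/\ injective f, forall x, f x \in S
                        & forall x y, adj x y -> r (f x) (f y)])
  \/ (exists f : H -> T, [/\ injective f, forall x, f x \in S
                        & forall x y, adj x y -> ~~ r (f x) (f y)]).
Proof.
move=> symr arrM leM; pose e (i : 'I_M) : T := enum_val (widen_ord leM i).
have e_inj : injective e by move=> i j /enum_val_inj/(congr1 val)/= /val_inj.
have eS i : e i \in S by apply: enum_valP.
pose c (E : {set 'I_M}) := [exists x, exists y, (E == [set x; y]) && r (e x) (e y)].
have cE x y : c [set x; y] = r (e x) (e y).
  apply/existsP/idP=> [[x' /existsP[y' /andP[/eqP eqE]]] | rxy]; last first.
    by exists x; apply/existsP; exists y; rewrite eqxx.
  have : (x' \in [set x; y]) && (y' \in [set x; y]) by rewrite eqE !inE !eqxx orbT.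
  have : (x \in [set x'; y']) && (y \in [set x'; y']) by rewrite -eqE !inE !eqxx orbT.
  rewrite !inE => /andP[/orP[]/eqP hx /orP[]/eqP hy] /andP[/orP[]/eqP hx' /orP[]/eqP hy'];
    by subst; rewrite // symr.
have [[f [f_inj f_hom]] | [f [f_inj f_hom]]] := arrM c; [left | right];
  exists (e \o f); split=> [|x|x y xy] /=; try exact: inj_comp; try exact: eS.
  by have /andP[_] := f_hom x y xy; rewrite cE eqb_id.
by have /andP[_] := f_hom x y xy; rewrite cE eqbF_neg.
Qed.

(** The extremal colouring: [x] and [y] are joined by a red edge when they lie
    in the same block of [n - 1] consecutive integers. A connected red graph
    stays within one block, a blue clique has one vertex per block. *)
Lemma arrows_lower_bound (G : sgraph) p M :
  0 < #|G| -> is_connected G -> arrows M G (complete p.+1) ->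
  (#|G| - 1) * p + 1 <= M.
Proof.
move=> G_gt0 connG arrM; rewrite addn1 ltnNge; apply/negP=> leM.
set d := #|G| - 1 in leM.
pose r : rel 'I_M := fun x y => x %/ d == y %/ d.
have d_gt0 (x : 'I_M) : 0 < d.
  have: 0 < d * p by apply: leq_ltn_trans (leq0n x) (leq_trans (ltn_ord x) leM).
  by rewrite muln_gt0 => /andP[].
have [g _] := card_gt0P G_gt0.
have [||[f [f_inj _ f_hom]] | [f [f_inj _ f_hom]]] :=
    arrows_rel (S := setT) (r := r) _ arrM.
- by move=> x y; rewrite /r eq_sym.
- by rewrite cardsT card_ord.
- have d0 := d_gt0 (f g).
  have same_block x : f x %/ d = f g %/ d.
    have [q] := connectP (connG g x).
    elim/last_ind: q x => [|q y IHq] x /=; first by move=> _ ->.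
    rewrite rcons_path last_rcons => /andP[qP qy] ->.
    by have /eqP<- := f_hom _ _ qy; apply: IHq.
  have h_inj : injective (fun x => Ordinal (ltn_pmod (f x) d0)).
    move=> x y [eq_mod]; apply/f_inj/val_inj.
    by rewrite /= (divn_eq (f x) d) (divn_eq (f y) d) !same_block eq_mod.
  by have := leq_card _ h_inj; rewrite card_ord /d; lia.
have f_lt i : f i %/ d < p by rewrite ltn_divLR ?(d_gt0 (f i)) // mulnC (leq_trans _ leM).
have h_inj : injective (fun i => Ordinal (f_lt i)).
  move=> i j [eq_div]; apply/eqP/negPn/negP=> ij.
  by have := f_hom i j ij; rewrite /r eq_div eqxx.
by have := leq_card _ h_inj; rewrite !card_ord ltnn.
Qed.

Lemma Emb_PG (G : sgraph) : 0 < #|G| -> is_connected G -> Emb G -> PG G.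
Proof.
move=> G_gt0 connG embG [//|p] _; rewrite /good subSS subn0.
by split=> [|M]; [apply: Emb_arrows | apply: arrows_lower_bound].
Qed.

(** * Counting inequalities *)

(** Bernoulli's inequality with cleared denominators. *)
Lemma expn_succ_geq x m : x ^ m.+1 + m.+1 * x ^ m <= x.+1 ^ m.+1.
Proof.
elim: m => [|m IHm]; first by rewrite !expn1 expn0; lia.
rewrite (expnS x.+1); apply: leq_trans (leq_mul (leqnn _) IHm).
by rewrite !expnS; move: (x ^ m) => y; nia.
Qed.

(** The integer form of [(1 - 1/x)^x <= 1/2]. *)
Lemma expn_double x : 0 < x -> 2 * x.-1 ^ x <= x ^ x.
Proof.
case: x => // x _; apply: leq_trans (expn_succ_geq x x).
by rewrite /= [in leqRHS]mulSn -expnS; lia.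
Qed.

Section Averaging.
Variables (F : finType).

Lemma leq_average (W : F -> nat) q :
  0 < #|F| -> \sum_f W f <= q * #|F| -> exists f, W f <= q.
Proof.
move=> F_gt0 leW; apply/existsP; apply: contraLR leW.
rewrite negb_exists -ltnNge => /forallP gtW.
apply: (@leq_trans (\sum_(f : F) q.+1)).
  by rewrite sum_nat_const mulnC ltn_pmul2l.
by apply: leq_sum => f _; rewrite ltnNge.
Qed.

Lemma sum_card_exchange (D : finType) (P : F -> pred D) :
  \sum_f #|P f| = \sum_d #|[pred f | P f d]|.
Proof.
under eq_bigr do rewrite -sum1_card.
under [RHS]eq_bigr do rewrite -sum1_card.
by rewrite (exchange_big_dep xpredT).
Qed.
End Averaging.

(** * Random sequences *)

Section RandomSequence.
Variables (I E J : finType).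
Implicit Types (f : {ffun I -> E}) (B : J -> {set E}).

(** Independence of the entries of a random sequence: the entries with indices
    [idx j] all fall in their targets with probability at most
    [(s / #|E|)^#|J|]. *)
Lemma card_hit_at B s (idx : {ffun J -> I}) :
    injective idx -> (forall j, #|B j| <= s) ->
  #|[pred f : {ffun I -> E} | [forall j, f (idx j) \in B j]]| * #|E| ^ #|J|
    <= s ^ #|J| * #|E| ^ #|I|.
Proof.
move=> idx_inj leB.
pose F i := [pred e | [forall j, (idx j == i) ==> (e \in B j)]].
have -> : #|[pred f : {ffun I -> E} | [forall j, f (idx j) \in B j]]| = #|family F|.
  apply: eq_card => f; rewrite !inE; apply/forallP/familyP=> fB i.
    by apply/forall_inP=> j /eqP<-.
  by have /forall_inP/(_ i (eqxx _)) := fB (idx i).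
rewrite card_family foldrE big_map big_enum /=.
rewrite (bigID (mem (codom idx))) /=.
have -> : #|E| ^ #|I| = #|E| ^ #|J| * \prod_(i | i \notin codom idx) #|E|.
  rewrite prod_nat_const -expnD -(card_codom idx_inj); congr (_ ^ _).
  by rewrite -(cardC (mem (codom idx))).
rewrite [leqRHS]mulnA mulnAC; apply: leq_mul.
  rewrite leq_mul2r; apply/orP; right.
  rewrite -big_uniq /=; last by rewrite map_inj_uniq ?enum_uniq.
  rewrite big_map big_enum /= -prod_nat_const.
  apply: leq_prod => j _; apply: leq_trans (leB j); apply: subset_leq_card.
  by apply/subsetP=> e /forall_inP; apply.
by apply: leq_prod => i _; apply: max_card.
Qed.

(** The union bound over all ways of assigning to each target the index of an
    entry that hits it. Disjointness of the targets makes these indices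
    distinct, hence the corresponding entries independent. *)
Lemma card_hit_all B s :
    (forall e j j', e \in B j -> e \in B j' -> j = j') ->
    (forall j, #|B j| <= s) ->
  #|[pred f : {ffun I -> E} | [forall j, exists i, f i \in B j]]| * #|E| ^ #|J|
    <= (s * #|I|) ^ #|J| * #|E| ^ #|I|.
Proof.
move=> disjB leB.
pose X (idx : {ffun J -> I}) := [pred f : {ffun I -> E} | [forall j, f (idx j) \in B j]].
have leX : #|[pred f : {ffun I -> E} | [forall j, exists i, f i \in B j]]|
             <= \sum_(idx : {ffun J -> I} | injectiveb idx) #|X idx|.
  under eq_bigr do rewrite -sum1_card.
  rewrite (exchange_big_dep xpredT) //= -sum1_card big_mkcond /=.
  apply: leq_sum => f _; case: ifP => //; rewrite inE => /forallP fB.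
  have {}fB j : {i | f i \in B j} by apply/sigW/existsP.
  pose idx := [ffun j => sval (fB j)].
  have idxB j : f (idx j) \in B j by rewrite ffunE; apply: (svalP (fB j)).
  rewrite (bigD1 idx) //=; apply/andP; split; last by apply/forallP.
  apply/injectiveP=> j j' eq_idx.
  by apply: disjB (idxB j) _; rewrite eq_idx.
apply: leq_trans (leq_mul leX (leqnn _)) _; rewrite big_distrl /=.
apply: (@leq_trans (\sum_(idx : {ffun J -> I} | injectiveb idx)
                      s ^ #|J| * #|E| ^ #|I|)).
  by apply: leq_sum => idx /injectiveP idx_inj; apply: card_hit_at.
rewrite sum_nat_const expnMn mulnA leq_mul2r; apply/orP; right.
rewrite mulnC leq_mul2l; apply/orP; right.
by rewrite -card_ffun; apply: max_card.
Qed.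
End RandomSequence.

(** * Random graphs of constant average degree *)

Section RandomGraph.
Variables (V I : finType).
Implicit Types (f : {ffun I -> V * V}).

(** Repeated pairs are allowed, and so are pairs [(x, x)]: loops are harmless,
    since independence and cycles only involve pairs of distinct vertices. *)
Definition edge_rel f : rel V :=
  fun x y => [exists i, (f i == (x, y)) || (f i == (y, x))].

Lemma edge_rel_sym f : symmetric (edge_rel f).
Proof. by move=> x y; apply: eq_existsb => i; rewrite orbC. Qed.

Definition independent f (A : {set V}) :=
  [forall x in A, forall y in A, (x != y) ==> ~~ edge_rel f x y].

(** At least [b (b + 1)] ordered pairs of distinct vertices of [A] must be
    avoided by every entry of the sequence. *)
Lemma card_independent b (A : {set V}) :
  b < #|A| -> #|[pred f : {ffun I -> V * V} | independent f A]| <= (#|V| ^ 2 - b ^ 2) ^ #|I|.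
Proof.
move=> ltbA; pose off := [set e : V * V | [&& e.1 \in A, e.2 \in A & e.1 != e.2]].
have le_off : b ^ 2 <= #|off|.
  have: #|setX A A| <= #|off :|: [set (x, x) | x in A]|.
    apply: subset_leq_card; apply/subsetP=> -[x y]; rewrite !inE /= => /andP[xA yA].
    rewrite xA yA /=; case: eqVneq => //= <-; exact: imset_f.
  have le_diag : #|[set (x, x) | x in A]| <= #|A| by apply: leq_imset_card.
  have [le_sum _] := leq_card_setU off [set (x, x) | x in A].
  by rewrite cardsX; nia.
apply: (@leq_trans (#|~: off| ^ #|I|)); last first.
  have le_off' : #|~: off| <= #|V| ^ 2 - b ^ 2.
    by have := cardsC off; rewrite card_prod mulnn; lia.
  by case: #|I| => // n; rewrite leq_exp2r.
rewrite -(card_ffun_on I (mem (~: off))); apply: subset_leq_card.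
apply/subsetP=> f; rewrite inE => indf; apply/ffun_onP=> i.
rewrite !inE; apply/negP=> /and3P[xA yA xy].
have /implyP/(_ xy) := forall_inP (forall_inP indf _ xA) _ yA.
by case/existsP; exists i; rewrite -surjective_pairing eqxx.
Qed.

(** A cycle of length at least 3 has one labelling for each choice of a starting
    vertex and a direction; counting all of them only changes a constant. *)
Definition kcycle k (r : rel V) (v : {ffun 'I_k -> V}) :=
  injectiveb v && [forall j, r (v j) (v (ordS j))].

Lemma ordS2_neq k (j : 'I_k) : 2 < k -> ordS (ordS j) != j.
Proof.
move=> k_gt2; rewrite -val_eqE /=; have := ltn_ord j.
rewrite leq_eqVlt => /predU1P[jE | ltj].
  by rewrite jE modnn modn_small; lia.
rewrite (modn_small ltj); move: ltj; rewrite leq_eqVlt => /predU1P[jE | ltj2].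
  by rewrite jE modnn; lia.
by rewrite modn_small //; lia.
Qed.

(** For [k > 2] the [k] edges of a cycle are distinct, so each of them has to be
    hit, in one of its two orientations, by a different entry of the
    sequence. *)
Lemma card_kcycle k (v : {ffun 'I_k -> V}) : 2 < k ->
  #|[pred f : {ffun I -> V * V} | kcycle (edge_rel f) v]| * #|V| ^ (2 * k)
    <= (2 * #|I|) ^ k * #|V| ^ (2 * #|I|).
Proof.
move=> k_gt2.
have [v_inj | ninj] := boolP (injectiveb v); last first.
  rewrite (_ : #|_| = 0) ?mul0n //; apply: eq_card0 => f.
  by rewrite !inE /kcycle (negPf ninj).
move/injectiveP: v_inj => v_inj.
pose B j := [set (v j, v (ordS j)); (v (ordS j), v j)].
have disjB e j j' : e \in B j -> e \in B j' -> j = j'.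
  move=> /set2P[] -> /set2P[] [] /v_inj e1 /v_inj e2 //.
  - by have:= ordS2_neq j k_gt2; rewrite e2 -e1 eqxx.
  - by have:= ordS2_neq j k_gt2; rewrite e1 -e2 eqxx.
have leB j : #|B j| <= 2 by rewrite cards2; case: (_ != _).
have := card_hit_all I disjB leB.
rewrite card_prod card_ord !mulnn -!expnM; apply: leq_trans.
rewrite leq_mul2r; apply/orP; right; apply: subset_leq_card.
apply/subsetP=> f; rewrite !inE => /andP[_ /forallP cyc]; apply/forallP=> j.
by have /existsP[i fi] := cyc j; apply/existsP; exists i; rewrite !inE.
Qed.
End RandomGraph.

(** With [2 (n + 1)^2 N] entries the probability that a given set of more than [b]
    vertices is independent is at most [4^-N], which beats the [2^N] choices of
    the set. *)
Lemma leq_independent_sets N n b : 0 < b -> N = n.+1 * b ->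
  4 ^ N * (N ^ 2 - b ^ 2) ^ (2 * n.+1 ^ 2 * N) <= N ^ (2 * (2 * n.+1 ^ 2 * N)).
Proof.
move=> b_gt0 NE.
have: 0 < n.+1 ^ 2 by [].
have: N ^ 2 = n.+1 ^ 2 * b ^ 2 by rewrite NE expnMn.
move: (n.+1 ^ 2) => x NE2 x_gt0.
rewrite NE2 (_ : _ - _ = x.-1 * b ^ 2); last by rewrite -subn1 mulnBl mul1n.
rewrite (expnM N) NE2 !expnMn mulnA leq_mul2r; apply/orP; right.
rewrite [2 * x]mulnC !(expnM _ _ N) -expnMn -[4]/(2 ^ 2) !(expnM _ x 2) -expnMn.
have [-> // | N_gt0] := posnP N.
by rewrite !leq_exp2r // expn_double.
Qed.

(** The weight [2^N * #bad + #cycles] has average at most [C]. As [C < 2^N], a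
    sequence of weight at most [C] has no bad set at all, and at most [C < b]
    labelled cycles. The set [S] omits the initial vertex of each of them. *)
Lemma sparse_graph_few_independent n k : 2 < k ->
  exists (b : nat) (V : finType) (r : rel V) (S : {set V}),
    [/\ 1 < b /\ n * b < #|S|, symmetric r,
        forall v : {ffun 'I_k -> V}, kcycle r v -> exists j, v j \notin S
      & forall A : {set V}, b < #|A| ->
          exists x y, [/\ x \in A, y \in A, x != y & r x y]].
Proof.
move=> k_gt2; pose d := 2 * n.+1 ^ 2; pose C := (2 * d) ^ k + 1; pose b := C.+1.
pose N := n.+1 * b; pose V := 'I_N; pose I := 'I_(d * N).
have b_gt1 : 1 < b by rewrite /b /C addn1.
have N_gt0 : 0 < N by rewrite muln_gt0 /= ltnW.
pose bad (f : {ffun I -> V * V}) := [pred A : {set V} | (b < #|A|) && independent f A].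
pose cyc (f : {ffun I -> V * V}) := [pred v : {ffun 'I_k -> V} | kcycle (edge_rel f) v].
have card_f : #|{ffun I -> V * V}| = N ^ (2 * (d * N)).
  by rewrite card_ffun card_prod !card_ord mulnn -expnM.
have sum_bad : 2 ^ N * \sum_f #|bad f| <= #|{ffun I -> V * V}|.
  rewrite card_f; apply: leq_trans (leq_independent_sets (ltnW b_gt1) (erefl N)).
  rewrite -[4]/(2 * 2) expnMn -mulnA leq_mul2l; apply/orP; right.
  rewrite sum_card_exchange.
  have -> : 2 ^ N = #|{set V}| by rewrite -cardsT -powersetT card_powerset cardsT card_ord.
  rewrite -sum_nat_const; apply: leq_sum => A _.
  have [ltA | geA] := ltnP b #|A|; last first.
    by rewrite eq_card0 // => f; rewrite !inE ltnNge geA.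
  have := card_independent I ltA; rewrite !card_ord; apply: leq_trans.
  by apply: subset_leq_card; apply/subsetP=> f; rewrite !inE => /andP[].
have sum_cyc : \sum_f #|cyc f| <= (2 * d) ^ k * #|{ffun I -> V * V}|.
  rewrite sum_card_exchange card_f -(leq_pmul2r (_ : 0 < N ^ (2 * k))) ?expn_gt0 ?N_gt0 //.
  rewrite big_distrl /=.
  apply: (@leq_trans (\sum_(v : {ffun 'I_k -> V}) (2 * (d * N)) ^ k * N ^ (2 * (d * N)))).
    apply: leq_sum => v _; have := card_kcycle I v k_gt2; rewrite !card_ord; exact: leq_trans.
  rewrite sum_nat_const card_ffun !card_ord (mulnA 2 d N) expnMn (mul2n k) -addnn expnD.
  by move: (N ^ k) (_ ^ k) (_ ^ (_ * _)) => t1 t2 t3; lia.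
have [||f] := @leq_average _ (fun f => 2 ^ N * #|bad f| + #|cyc f|) C.
- by rewrite card_f expn_gt0 N_gt0.
- by rewrite big_split /= -big_distrr /= mulnDl mul1n addnC leq_add.
move=> leC.
have bad0 : #|bad f| = 0.
  apply/eqP; apply: contraTT leC; rewrite -lt0n -ltnNge => bad_gt0.
  apply: (@leq_trans (2 ^ N)); last exact: leq_trans (leq_pmulr _ bad_gt0) (leq_addr _ _).
  apply: leq_trans (ltnW (ltn_expl N (ltnSn 1))); rewrite /N mulSn /b; lia.
pose j0 := Ordinal (ltnW (ltnW k_gt2)).
pose X : {set V} := [set v j0 | v : {ffun 'I_k -> V} in cyc f].
exists b, V, (edge_rel f), (~: X); split.
- split=> //; have leX : #|X| <= C.
    by apply: leq_trans (leq_imset_card _ _) (leq_trans (leq_addl _ _) leC).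
  have := cardsC X; rewrite card_ord => cardX.
  by rewrite -(ltn_add2l #|X|) cardX [ltnRHS]mulSn ltn_add2r ltnS.
- exact: edge_rel_sym.
- by move=> v cycv; exists j0; rewrite inE negbK; apply: imset_f.
move=> A ltA; have := card0_eq bad0 A; rewrite !inE ltA /=.
move/negbT; rewrite negb_forall_in => /exists_inP[x xA].
rewrite negb_forall_in => /exists_inP[y yA].
by rewrite negb_imply negbK => /andP[xy rxy]; exists x, y.
Qed.

(** * Cycles and trees *)

Lemma ucycle_kcycle (G : sgraph) (s : seq G) :
  0 < size s -> ucycle (@adj G) s ->
  exists v : {ffun 'I_(size s) -> G}, kcycle (@adj G) v.
Proof.
case: s => // x0 s _ /andP[cyc_s uniq_s].
exists [ffun i : 'I_(size (x0 :: s)) => nth x0 (x0 :: s) i].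
apply/andP; split.
  apply/injectiveP=> i j; rewrite !ffunE => /eqP.
  by rewrite nth_uniq // => /eqP/val_inj.
apply/forallP=> j; rewrite !ffunE.
have := next_cycle cyc_s (mem_nth x0 (ltn_ord j)).
rewrite next_nth mem_nth // index_uniq //.
(* At the last index the default value x0 is the vertex that closes the cycle. *)
suff -> : nth x0 s j = nth x0 (x0 :: s) (ordS j) by [].
rewrite /=; have := ltn_ord j; rewrite /= ltnS leq_eqVlt => /predU1P[-> | ltj].
  by rewrite modnn nth_default.
by rewrite modn_small.
Qed.

Lemma kcycle_hom k (V W : finType) (r : rel V) (r' : rel W) (g : V -> W)
    (v : {ffun 'I_k -> V}) :
  injective g -> (forall x y, r x y -> r' (g x) (g y)) ->
  kcycle r v -> kcycle r' [ffun i => g (v i)].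
Proof.
move=> g_inj g_hom /andP[/injectiveP v_inj /forallP cyc].
apply/andP; split; last by apply/forallP=> j; rewrite !ffunE; apply: g_hom.
by apply/injectiveP=> i j; rewrite !ffunE => /g_inj/v_inj.
Qed.

(** The graph without [k]-cycles, completed by its blue complement, contradicts
    the Ramsey number for [p = b + 1]. *)
Lemma PG_tree (G : sgraph) : 0 < #|G| -> is_connected G -> PG G -> is_tree G.
Proof.
move=> G_gt0 connG pgG; split=> // -[s [s_gt2 cyc_s]].
have [v cycv] := ucycle_kcycle (ltnW (ltnW s_gt2)) cyc_s.
have [b [V [r [S [[b_gt1 ltS] r_sym no_cycle few_indep]]]]] :=
  sparse_graph_few_independent (#|G| - 1) s_gt2.
have [arrG _] := pgG b.+1 b_gt1.
rewrite subSS subn0 in arrG.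
have [| [f [f_inj fS f_hom]] | [f [f_inj fS f_hom]]] := arrows_rel r_sym arrG (S := S).
- by rewrite addn1.
- have [j] := no_cycle _ (kcycle_hom f_inj f_hom cycv).
  by rewrite ffunE fS.
have [|_ [_ [/imsetP[i _ ->] /imsetP[j _ ->]]]] := few_indep (f @: setT).
  by rewrite card_imset // cardsT card_ord.
by rewrite (inj_eq f_inj) => ij /idPn[]; apply: f_hom.
Qed.

Theorem theorem5 :
  (forall G : sgraph, 0 < #|G| -> is_connected G ->
     [<-> is_tree G; Emb G; PG G])
  /\
  (forall G : sgraph, 0 < #|G| ->
     ((is_connected G /\ PG G) <-> is_tree G)).
Proof.
have equiv (G : sgraph) : 0 < #|G| -> is_connected G -> [<-> is_tree G; Emb G; PG G].
  move=> G_gt0 connG; tfae; first exact: tree_Emb.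
    exact: Emb_PG.
  exact: PG_tree.
split=> // G G_gt0; split=> [[connG] | treeG].
  exact: (equiv G G_gt0 connG 2 0).1.
by split; [case: treeG | apply: (equiv G G_gt0 treeG.1 0 2).1].
Qed.
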